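(* Let $\mathcal{X}\subseteq\mathbb{R}^d$ be a nonempty, convex and compact set with diameter $R$ (so $\|x_1-x_2\|\le R$ for all $x_1,x_2\in\mathcal{X}$). Let $f:\mathbb{R}^d\to\mathbb{R}$ be differentiable, weakly pseudo-convex on $\mathcal{X}$, and satisfy the acute angle condition on $\mathcal{X}$ for some $\phi\in[0,\pi/2)$. Suppose that the corruption probability $p\ge0$ satisfies $$p<\frac{\cos\phi}{1+\cos\phi}.$$ Let $q\in\left[p,\frac{\cos\phi}{1+\cos\phi}\right)$, let $$\gamma=\frac{R}{2\left((1-q)\cos\phi-q\right)},$$ and set the step sizes $\gamma_t=\gamma/t$ for $t\ge1$. Then the iterates $(x_t)_{t\ge1}$ generated by the normalized subgradient method with randomly corrupted gradients (corruption probability $p$, arbitrary corrupt feedback $b_t$), started from any $x_1\in\mathcal{X}$, satisfy, for every $T\ge1$, $$\mathbb{E}\left[\|x_{T+1}-x^\star(x_{T+1})\|^2\right]\le\frac{\gamma^2(1+\log T)}{T},$$ and $$\lim_{t\to\infty}\|x_t-x^\star(x_t)\|^2=0\quad\text{almost surely}.$$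
   Context: $\|\cdot\|$ is the Euclidean norm on $\mathbb{R}^d$, $\langle\cdot,\cdot\rangle$ the standard inner product, $\Pi_{\mathcal{X}}$ the Euclidean projection onto $\mathcal{X}$, and $g(x)=\nabla f(x)$ ($f$ need not be convex). The set of minima of $f$ is $\arg\min_{x\in\mathcal{X}}f(x)$, and $x^\star(x)$ denotes the point of this set nearest to $x$ (a fixed choice of one if there are several); $f(x^\star)$ denotes the minimum value of $f$ over $\mathcal{X}$. $f$ is weakly pseudo-convex on $\mathcal{X}$ if there exists $K>0$ such that for all $x\in\mathcal{X}$ $$f(x)-f(x^\star)\le K\frac{\langle g(x),x-x^\star(x)\rangle}{\|g(x)\|},$$ with the convention $g(x)/\|g(x)\|=0$ if $g(x)=0$. Acute angle condition for $\phi\in[0,\pi/2)$: for all $x\in\mathcal{X}$, $$\langle g(x),x-x^\star(x)\rangle\ge\cos\phi\,\|g(x)\|\,\|x-x^\star(x)\|.$$ Randomly corrupted feedback: at each iteration $t\ge1$, given $x_t$, the received feedback is $h_t=g(x_t)$ if $Y_t=0$ and $h_t=b_t$ if $Y_t=1$, where $Y_t$ is a Bernoulli($p$) random variable ($\mathbb{P}(Y_t=1)=p$) independent of the history up to the beginning of iteration $t$ (i.e. of $x_1,\dots,x_t$, $Y_1,\dots,Y_{t-1}$, $b_1,\dots,b_{t-1}$). The corrupt feedback $b_t$ is an arbitrary $\mathbb{R}^d$-valued random vector, with no bound on its norm or moments; it may be chosen by an adversary with full knowledge of the problem. Normalized subgradient method: start from a (deterministic) $x_1\in\mathcal{X}$;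 for $t=1,2,\dots$, set $$x_{t+1}=\Pi_{\mathcal{X}}\left(x_t-\gamma_t\frac{h_t}{\|h_t\|}\right)\ \text{ if }\|h_t\|>0,\qquad x_{t+1}=x_t\ \text{ if }\|h_t\|=0.$$ *)

(* Defs.v *)
From HB Require Import structures.
From mathcomp Require Import all_boot all_order all_algebra.
From mathcomp Require Import all_classical all_reals all_analysis.

Set Implicit Arguments.
Unset Strict Implicit.
Unset Printing Implicit Defensive.

Import Order.TTheory GRing.Theory Num.Theory.
Import numFieldNormedType.Exports.

Local Open Scope classical_set_scope.
Local Open Scope ring_scope.

(* The library norm on ['rV[R]_d] is the
   sup norm, hence the explicit Euclidean norm below; both norms induce the
   same topology, so the library's [compact], [open] and [differentiable] on
   ['rV[R]_d] are the usual notions. *)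

Section euclidean.
Context {R : realType} {d : nat}.
Implicit Types (u v x y : 'rV[R]_d) (A X : set 'rV[R]_d) (f : 'rV[R]_d -> R).

Definition dot u v : R := \sum_(i < d) u 0 i * v 0 i.

Definition enorm u : R := Num.sqrt (dot u u).

Definition diameter A : R := sup [set enorm (u - v) | u in A & v in A].

Definition grad f x : 'rV[R]_d := \row_(i < d) 'D_(delta_mx 0 i) f x.

Definition nearest A x y : Prop :=
  A y /\ forall z, A z -> enorm (x - y) <= enorm (x - z).

(* The nearest point is unique when [X] is nonempty, closed and convex; the
   default value [x] of [xget] is never used in that case. *)
Definition proj X x : 'rV[R]_d := xget x [set y | nearest X x y].

Definition argmin X f : set 'rV[R]_d :=
  [set y | X y /\ forall z, X z -> f y <= f z].

(* In the next two definitions [xstar] selects a nearest point of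
   [argmin X f], so that [f (xstar x)] is the minimum of [f] over [X]. *)

(* As [r / 0 = 0], the right-hand side is [0] when [grad f x = 0], which is
   the convention [g / ||g|| = 0] for [g = 0]. *)
Definition weakly_pseudo_convex X f (xstar : 'rV[R]_d -> 'rV[R]_d) : Prop :=
  exists2 K : R, 0 < K & forall x, X x ->
    f x - f (xstar x) <= K * (dot (grad f x) (x - xstar x) / enorm (grad f x)).

Definition acute_angle X f (xstar : 'rV[R]_d -> 'rV[R]_d) (phi : R) : Prop :=
  forall x, X x ->
    cos phi * enorm (grad f x) * enorm (x - xstar x)
      <= dot (grad f x) (x - xstar x).

Definition normalized_step X (c : R) h x : 'rV[R]_d :=
  if 0 < enorm h then proj X (x - c *: ((enorm h)^-1 *: h)) else x.

End euclidean.

Definition borel_rV (R : realType) (d : nat) :=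
  g_sigma_algebraType (@open 'rV[R]_d).

Section probability.
Context {disp : measure_display} {Omega : measurableType disp}.

Definition preimage_events {disp' : measure_display}
    {E : measurableType disp'} (Z : Omega -> E) : set (set Omega) :=
  preimage_set_system [set: Omega] Z measurable.

Definition independent_of {R : realType} (P : probability Omega R)
    {disp' : measure_display} {E : measurableType disp'} (Z : Omega -> E)
    (G : set (set Omega)) : Prop :=
  forall B A, measurable B -> G A ->
    P (Z @^-1` B `&` A) = (P (Z @^-1` B) * P A)%E.

Definition history {R : realType} {d : nat}
    (x b : nat -> Omega -> borel_rV R d) (Y : nat -> Omega -> bool) (t : nat) :
    set (set Omega) :=
  <<s (\bigcup_(s in [set s | (1 <= s <= t)%N]) preimage_events (x s)) `|`
      (\bigcup_(s in [set s | (1 <= s < t)%N])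
         (preimage_events (Y s) `|` preimage_events (b s))) >>.

End probability.

(* [true] is the corrupted outcome. No relation is imposed between [b t] and
   [x 1, ..., x t, Y 1, ..., Y t, b 1, ..., b t.-1]. All processes are indexed
   from time 1; their values at index 0 are irrelevant. *)
Definition feedback (R : realType) (d : nat) (disp : measure_display)
    (Omega : measurableType disp) (f : 'rV[R]_d -> R)
    (x b : nat -> Omega -> 'rV[R]_d) (Y : nat -> Omega -> bool)
    (t : nat) (w : Omega) : 'rV[R]_d :=
  if Y t w then b t w else grad f (x t w).

(* Main.v *)
Require Import Defs.
From HB Require Import structures.
From mathcomp Require Import all_boot all_order all_algebra.
From mathcomp Require Import all_classical all_reals all_analysis.
From mathcomp Require Import measurable_realfun zify ring lra.
Import Order.TTheory GRing.Theory Num.Theory.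
Import numFieldNormedType.Exports.
Local Open Scope classical_set_scope.
Local Open Scope ring_scope.

(** Write [D t] for the distance from [x t] to the set of minimizers. The
    projection is nonexpansive and the directions have norm at most [1], so
    an honest step of length [c] replaces [D^2] by at most
    [D^2 - 2 c cos phi D + c^2], while a corrupted one costs at most
    [D^2 + 2 c D + c^2], whatever the adversary sends ([dist_argmin_step]).
    The corruption flag is independent of [D t], so in mean the drift is
    [- 2 c ((1 - p) cos phi - p) E[D]] ([expected_step]). The threshold on
    [q] makes this coefficient positive. With [c = gamma / t] and
    [D^2 <= M D], where [M] is the diameter of [X], the choice of [gamma] gives
    [u (t+1) <= (1 - 1/t) u t + gamma^2 / t^2] for [u t = E[(D t)^2]].
    Multiplying by [t] telescopes the recursion, which leaves a harmonic sum
    and hence the rate [gamma^2 (1 + log T) / T] ([recursion_ln_bound]).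

    The rate also gives almost sure convergence. Along the times [k^3 + 1] it
    is summable, so the sum of [(D (k^3 + 1))^2] has finite mean and its terms
    tend to [0] almost surely ([ae_cvg0_of_summable]). Between consecutive
    cubes there are [O(k^2)] steps, each of which moves [D^2] by [O(1 / k^3)]
    on every trajectory, so the whole sequence follows
    ([cvg0_of_cube_subsequence]).

    The means require the iterates to be Borel measurable. This is checked
    coordinate by coordinate ([measurable_rV]): the projection and the
    distance are Lipschitz, and a partial derivative is a pointwise limit of
    continuous difference quotients. *)

(** * Euclidean geometry *)

Section euclidean_geometry.
Context {R : realType} {d : nat}.
Implicit Types (u v x y z : 'rV[R]_d) (A X : set 'rV[R]_d) (c : R).

Lemma dotC u v : dot u v = dot v u.
Proof. by apply: eq_bigr => i _; rewrite mulrC. Qed.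

Lemma dotDl u v z : dot (u + v) z = dot u z + dot v z.
Proof. by rewrite -big_split; apply: eq_bigr => i _; rewrite mxE mulrDl. Qed.

Lemma dotZl c u v : dot (c *: u) v = c * dot u v.
Proof. by rewrite mulr_sumr; apply: eq_bigr => i _; rewrite mxE mulrA. Qed.

Lemma dotNl u v : dot (- u) v = - dot u v.
Proof. by rewrite -scaleN1r dotZl mulN1r. Qed.

Lemma dotBl u v z : dot (u - v) z = dot u z - dot v z.
Proof. by rewrite dotDl dotNl. Qed.

Lemma dotDr u v z : dot z (u + v) = dot z u + dot z v.
Proof. by rewrite ![dot z _]dotC dotDl. Qed.

Lemma dotZr c u v : dot v (c *: u) = c * dot v u.
Proof. by rewrite ![dot v _]dotC dotZl. Qed.

Lemma dotBr u v z : dot z (u - v) = dot z u - dot z v.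
Proof. by rewrite ![dot z _]dotC dotBl. Qed.

Lemma dot_ge0 u : 0 <= dot u u.
Proof. by apply: sumr_ge0 => i _; rewrite -expr2 sqr_ge0. Qed.

Lemma enorm_ge0 u : 0 <= enorm u. Proof. exact: sqrtr_ge0. Qed.

Lemma sqr_enorm u : enorm u ^+ 2 = dot u u.
Proof. by rewrite sqr_sqrtr// dot_ge0. Qed.

Lemma enorm0 : enorm (0 : 'rV[R]_d) = 0.
Proof.
by rewrite /enorm /dot big1 ?sqrtr0// => i _; rewrite mxE mulr0.
Qed.

Lemma enormZ c u : enorm (c *: u) = `|c| * enorm u.
Proof.
by rewrite /enorm dotZl dotZr mulrA -expr2 sqrtrM ?sqr_ge0// sqrtr_sqr.
Qed.

Lemma enormN u : enorm (- u) = enorm u.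
Proof. by rewrite -scaleN1r enormZ normrN1 mul1r. Qed.

Lemma enormC u v : enorm (u - v) = enorm (v - u).
Proof. by rewrite -enormN opprB. Qed.

Lemma sqr_enormB u v :
  enorm (u - v) ^+ 2 = enorm u ^+ 2 - 2 * dot u v + enorm v ^+ 2.
Proof. by rewrite !sqr_enorm !(dotBl, dotBr) (dotC v u); ring. Qed.

Lemma enorm_coord u i : `|u 0 i| <= enorm u.
Proof.
rewrite -sqrtr_sqr ler_wsqrtr// /dot (bigD1 i)//= -expr2 lerDl.
by apply: sumr_ge0 => j _; rewrite -expr2 sqr_ge0.
Qed.

Lemma enorm_eq0 u : enorm u = 0 -> u = 0.
Proof.
move=> u0; apply/rowP => i; rewrite mxE; apply/eqP; rewrite -normr_le0.
by rewrite -u0 enorm_coord.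
Qed.

(** Expanding the square norm of [enorm v *: u - enorm u *: v]. *)
Lemma cauchy_schwarz u v : dot u v <= enorm u * enorm v.
Proof.
have [->|u0] := eqVneq u 0.
  by rewrite enorm0 mul0r /dot big1// => i _; rewrite mxE mul0r.
have [->|v0] := eqVneq v 0.
  by rewrite enorm0 mulr0 /dot big1// => i _; rewrite mxE mulr0.
have gt0 (w : 'rV[R]_d) : w != 0 -> 0 < enorm w.
  move=> w0; rewrite lt_def enorm_ge0 andbT.
  by apply: contra w0 => /eqP/enorm_eq0->.
have := dot_ge0 (enorm v *: u - enorm u *: v).
rewrite !(dotBl, dotBr, dotZl, dotZr) -!sqr_enorm (dotC v u).
rewrite (_ : _ - _ = 2 * (enorm u * enorm v) * (enorm u * enorm v - dot u v));
  last by ring.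
by rewrite pmulr_rge0 ?subr_ge0// !mulr_gt0// gt0.
Qed.

Lemma ler_enormD u v : enorm (u + v) <= enorm u + enorm v.
Proof.
rewrite -[leRHS]ger0_norm ?addr_ge0 ?enorm_ge0// -sqrtr_sqr ler_wsqrtr//.
rewrite !(dotDl, dotDr) (dotC v u) sqrrD !sqr_enorm.
by have := cauchy_schwarz u v; lra.
Qed.

Lemma ler_enorm_dist x y z : enorm (x - z) <= enorm (x - y) + enorm (y - z).
Proof. by rewrite (le_trans _ (ler_enormD _ _))// subrKA. Qed.

Lemma enorm_continuous : continuous (@enorm R d).
Proof.
move=> u; apply: continuous_comp; last exact: sqrt_continuous.
apply: continuous_big => [|i _ v]; first exact: add_continuous.
by apply: (@cvgM _ _ (nbhs v)); apply: coord_continuous.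
Qed.

Lemma enormB_continuous y : continuous (fun x => enorm (y - x)).
Proof.
move=> x; apply: (@continuous_comp _ _ _ (fun x => y - x)); last exact: enorm_continuous.
by apply: (@cvgB _ _ _ (nbhs x)); [exact: cvg_cst|exact: cvg_id].
Qed.

(** The sup norm and the Euclidean norm induce the same topology, so
    Euclidean Lipschitz continuity gives continuity. *)
Lemma enorm_lipschitz_continuous (g : 'rV[R]_d -> R) :
  (forall x y, `|g x - g y| <= enorm (x - y)) -> continuous g.
Proof.
move=> gL x; have dist0 : enorm (x - y) @[y --> x] --> (0 : R).
  by have := enormB_continuous x x; rewrite /continuous_at subrr enorm0.
apply/(@cvgrPdist_lt _ _ _ (nbhs x)) => e e0; near=> y.
by rewrite (le_lt_trans (gL _ _))//; near: y; exact: (cvgr_lt 0).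
Unshelve. all: by end_near. Qed.

(** For every selection [s] of nearest points, [enorm (x - s x)] is the distance
    from [x] to [A], which is [1]-Lipschitz by the triangle inequality. *)
Lemma nearest_dist_lipschitz A (s : 'rV[R]_d -> 'rV[R]_d) :
  (forall y, nearest A y (s y)) ->
  forall x y, `|enorm (x - s x) - enorm (y - s y)| <= enorm (x - y).
Proof.
move=> sP.
suff h x y : enorm (x - s x) <= enorm (x - y) + enorm (y - s y).
  move=> x y; have := h x y; have := h y x; rewrite (enormC y x) ler_norml.
  by move=> ? ?; apply/andP; split; lra.
apply: le_trans (ler_enorm_dist _ _ _).
by have [_ ->] := sP x; rewrite //; case: (sP y).
Qed.

Lemma compact_enorm_bounded A : compact A ->
  exists M, forall x y, A x -> A y -> enorm (x - y) <= M.
Proof.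
move=> /compact_bounded/ex_strict_bound_gt0 [M M0 AM].
exists ((M + M) * enorm (const_mx 1 : 'rV[R]_d)) => x y Ax Ay.
have h i : `|(x - y) 0 i| <= M + M.
  have c z : A z -> `|z 0 i| <= M.
    move=> Az; apply/ltW; apply: le_lt_trans (AM _ Az).
    rewrite [leRHS](_ : _ = mx_norm z)// mx_normrE.
    by apply/bigmax_geP; right; exists (0, i).
  by rewrite !mxE (le_trans (ler_normB _ _))// lerD// c.
rewrite -[M + M]ger0_norm ?addr_ge0 ?(ltW M0)// -enormZ; apply: ler_wsqrtr.
apply: ler_sum => i _; have := h i; rewrite !mxE mulr1 -!expr2 => hi.
by rewrite -[leLHS]real_normK ?num_real// ler_sqr// nnegrE addr_ge0 ?(ltW M0).
Qed.

Lemma le_diameter A x y : compact A -> A x -> A y ->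
  enorm (x - y) <= diameter A.
Proof.
move=> /compact_enorm_bounded[M AM] Ax Ay; apply: sup_upper_bound.
  split; first by exists (enorm (x - y)); exists x => //; exists y.
  by exists M => _ [u Au [v Av <-]]; exact: AM.
by exists x => //; exists y.
Qed.

Lemma diameter_ge0 A x : compact A -> A x -> 0 <= diameter A.
Proof. by move=> cA Ax; rewrite -enorm0 -(subrr x) le_diameter. Qed.

End euclidean_geometry.

(** * Projection and normalized steps *)

Section projection.
Context {R : realType} {d : nat}.
Implicit Types (x y z h : 'rV[R]_d) (X : set 'rV[R]_d) (c : R).

Lemma proj_nearest X x : X !=set0 -> compact X -> nearest X x (Defs.proj X x).
Proof.
move=> X0 cX; apply: (xgetPex x).
have [|y /set_mem Xy ymin] := @compact_EVT_min _ _ (fun y => enorm (x - y)) X X0 cX.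
  by apply: continuous_subspaceT; exact: enormB_continuous.
by exists y; split=> // z Xz; apply: ymin; rewrite inE.
Qed.

(** The first-order condition for the minimum of the square distance along
    the segment from the projection to [z]. *)
Lemma proj_obtuse X x z : convex_set X -> compact X -> X z ->
  dot (x - Defs.proj X x) (z - Defs.proj X x) <= 0.
Proof.
move=> vX cX Xz; have X0 : X !=set0 by exists z.
have [Xp pmin] := proj_nearest X x X0 cX; set p := Defs.proj X x in Xp pmin *.
rewrite leNgt; apply/negP; set a := dot _ _ => a0.
set b := enorm (z - p) ^+ 2; have b0 : 0 <= b by exact: sqr_ge0.
have ab0 : 0 < a + b by rewrite ltr_pwDl.
(* The derivative of the square distance to [x] at [p] towards [z] is
   [- 2 a < 0], and [t] is a step short enough to beat the second-order term
   [t^2 b]. *)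
pose t := a / (a + b).
have t0 : 0 <= t by rewrite divr_ge0// ltW.
have t1 : t <= 1 by rewrite ler_pdivrMr// mul1r lerDl.
have Xt : X (p + t *: (z - p)).
  have -> : p + t *: (z - p) = t *: z + (1 - t) *: p.
    by rewrite scalerBl scale1r scalerBr addrCA.
  exact: set_mem (vX z p (Itv01 t0 t1) (mem_set Xz) (mem_set Xp)).
have := pmin _ Xt.
rewrite -ler_sqr ?nnegrE ?enorm_ge0// opprD addrA (sqr_enormB (x - p)).
rewrite dotZr -/a enormZ exprMn -/b real_normK ?num_real//.
have : t * (a + b) = a by rewrite divfK// gt_eqF.
have : 0 < t by rewrite divr_gt0.
by nra.
Qed.

Lemma proj_id X x : compact X -> X x -> Defs.proj X x = x.
Proof.
move=> cX Xx; have X0 : X !=set0 by exists x.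
have [_ /(_ _ Xx)] := proj_nearest X x X0 cX.
rewrite subrr enorm0 => h; apply/esym/eqP; rewrite -subr_eq0; apply/eqP.
by apply: enorm_eq0; apply/eqP; rewrite eq_le h enorm_ge0.
Qed.

Lemma proj_nonexpansive X x y : convex_set X -> compact X -> X !=set0 ->
  enorm (Defs.proj X x - Defs.proj X y) <= enorm (x - y).
Proof.
move=> vX cX X0.
have [Xp _] := proj_nearest X x X0 cX; have [Xq _] := proj_nearest X y X0 cX.
have := proj_obtuse X x _ vX cX Xq; have := proj_obtuse X y _ vX cX Xp.
set p := Defs.proj X x; set q := Defs.proj X y => h1 h2.
have : enorm (p - q) ^+ 2 <= dot (x - y) (p - q).
  by rewrite sqr_enorm; move: h1 h2; rewrite !(dotBl, dotBr); lra.
move=> /le_trans/(_ (cauchy_schwarz _ _)); rewrite expr2.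
have := enorm_ge0 (p - q); rewrite le_eqVlt => /orP[/eqP <-|pq0].
  by rewrite enorm_ge0.
by rewrite ler_pM2r.
Qed.

Lemma proj_nonexpansive_in X x z : convex_set X -> compact X -> X z ->
  enorm (Defs.proj X x - z) <= enorm (x - z).
Proof.
move=> vX cX Xz; rewrite -[in leLHS](proj_id X z cX Xz).
by apply: proj_nonexpansive => //; exists z.
Qed.

Lemma normalized_step_in X c h x : compact X -> X x ->
  X (normalized_step X c h x).
Proof.
move=> cX Xx; rewrite /normalized_step; case: ifP => // _.
by case: (proj_nearest X (x - c *: ((enorm h)^-1 *: h))) => //; exists x.
Qed.

Lemma enorm_normalize h : 0 < enorm h -> enorm ((enorm h)^-1 *: h) = 1.
Proof.
by move=> h0; rewrite enormZ ger0_norm ?invr_ge0 ?enorm_ge0// mulVf// gt_eqF.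
Qed.

Lemma normalized_step_move X c h x : convex_set X -> compact X -> X x ->
  0 <= c -> enorm (normalized_step X c h x - x) <= c.
Proof.
move=> vX cX Xx c0; rewrite /normalized_step.
case: ifPn => [h0|_]; last by rewrite subrr enorm0.
apply: le_trans (proj_nonexpansive_in _ _ _ vX cX Xx) _.
by rewrite addrAC subrr sub0r enormN enormZ ger0_norm// enorm_normalize// mulr1.
Qed.

(** When [h = 0] the quotient is [0] and the step does not move. *)
Lemma normalized_step_sqr_dist X c h x z : convex_set X -> compact X -> X z ->
  enorm (normalized_step X c h x - z) ^+ 2 <=
  enorm (x - z) ^+ 2 - 2 * c * (dot h (x - z) / enorm h) + c ^+ 2.
Proof.
move=> vX cX Xz; rewrite /normalized_step; case: ifPn => [h0|].
  have := proj_nonexpansive_in X (x - c *: ((enorm h)^-1 *: h)) z vX cX Xz.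
  rewrite -ler_sqr ?nnegrE ?enorm_ge0// addrAC => /le_trans; apply.
  rewrite (sqr_enormB (x - z)) !dotZr enormZ exprMn enorm_normalize// real_normK ?num_real//.
  by rewrite (dotC (x - z)) expr1n mulr1 mulrA [_^-1 * _]mulrC.
rewrite -leNgt => h0.
have -> : enorm h = 0 by apply/eqP; rewrite eq_le h0 enorm_ge0.
by rewrite invr0 !mulr0 subr0 lerDl sqr_ge0.
Qed.

Lemma ler_normalized_dot h x : - enorm x <= dot h x / enorm h.
Proof.
have [h0|h0] := eqVneq (enorm h) 0.
  by rewrite h0 invr0 mulr0 oppr_le0 enorm_ge0.
have hp : 0 < enorm h by rewrite lt_def h0 enorm_ge0.
rewrite ler_pdivlMr// -lerN2 mulNr opprK -dotNl mulrC -[enorm h]enormN.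
exact: cauchy_schwarz.
Qed.

End projection.

(** * Borel measurability in finite dimension *)

Section borel_measurability.
Context {R : realType} {d : nat}.
Context {disp : measure_display} {Omega : measurableType disp}.
Implicit Types (Z : Omega -> 'rV[R]_d).

(** An open set is a countable union of cubes with rational centers and
    radii, and the preimage of a cube is a finite intersection of events on
    the coordinates. *)
Lemma measurable_preimage_open Z (U : set 'rV[R]_d) :
  (forall i, measurable_fun setT (fun w => Z w 0 i)) -> open U ->
  measurable (Z @^-1` U).
Proof.
move=> mZ oU.
pose cube (c : 'rV[rat]_d * rat) : set 'rV[R]_d :=
  [set y | forall i, `|ratr (c.1 0 i) - y 0 i| < ratr c.2].
pose F c := if `[<cube c `<=` U>] then Z @^-1` cube c else set0.
have -> : Z @^-1` U = \bigcup_c F c.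
  apply/seteqP; split=> [w UZ|w [c _]]; last first.
    by rewrite /F; case: asboolP => // cU; exact: cU.
  have [e /= e0 eU] : exists2 e : R, 0 < e & ball (Z w) e `<=` U.
    by apply/nbhs_ballP; move: oU; rewrite openE; apply.
  have /rat_in_itvoo[r] : 0 < e / 2 by rewrite divr_gt0.
  rewrite in_itv/= => /andP[r0 re2].
  have cP i : {q : rat | `|ratr q - Z w 0 i| < ratr r}.
    apply: cid; have : Z w 0 i - ratr r < Z w 0 i + ratr r by lra.
    move=> /rat_in_itvoo[q]; rewrite in_itv/= => /andP[? ?]; exists q.
    by rewrite ltr_norml; apply/andP; split; lra.
  exists (\row_i sval (cP i), r) => //; rewrite /F; case: asboolP => [_|[]] /=.
    by move=> i; rewrite mxE; case: (cP i).
  move=> y /= cy; apply: eU; split=> // i j; rewrite (ord1 i).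
  have := cy j; rewrite mxE; case: (cP j) => q /= qZ qy.
  rewrite /ball/= -(subrKA (ratr q)) (le_lt_trans (ler_normD _ _))//.
  by move: qZ; rewrite distrC; lra.
apply: countable_bigcupT_measurable => [|c]; first exact: countableP.
rewrite /F; case: ifP => // _.
rewrite (_ : _ @^-1` _ = \bigcap_(i in [set: 'I_d])
    [set w | `|ratr (c.1 0 i) - Z w 0 i| < ratr c.2]); last first.
  by apply/seteqP; split=> [w h i _|w h i]; exact: h.
apply: fin_bigcap_measurable => // i _.
rewrite -[X in measurable X]setTI.
exact: (mZ i measurableT _ (measurable_ball (ratr (c.1 0 i)) (ratr c.2))).
Qed.

Lemma measurable_rV Z :
  (forall i, measurable_fun setT (fun w => Z w 0 i)) ->
  measurable_fun setT (Z : Omega -> borel_rV R d).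
Proof.
move=> mZ; apply: (@measurability _ _ Omega (borel_rV R d) _ _ (@open 'rV[R]_d) erefl).
move=> _ [U oU <-].
by rewrite setTI; exact: measurable_preimage_open.
Qed.

Lemma continuous_measurable_rV (g : 'rV[R]_d -> R) : continuous g ->
  measurable_fun setT (g : borel_rV R d -> R).
Proof.
move=> /continuousP cg; apply: (measurability _ (RGenOpens.measurableE R)).
move=> _ [_ [a [b ->] <-]]; rewrite setTI; apply: sub_sigma_algebra.
by apply: cg; exact: interval_open.
Qed.

Lemma measurable_rV_coord Z i :
  measurable_fun setT (Z : Omega -> borel_rV R d) ->
  measurable_fun setT (fun w => Z w 0 i).
Proof.
move=> mZ; apply: (measurableT_comp (continuous_measurable_rV (fun u => u 0 i) _) mZ).
exact: coord_continuous.
Qed.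

(** A partial derivative is the limit of the continuous difference quotients
    of step [1 / (n + 1)]. *)
Lemma measurable_grad (f : 'rV[R]_d -> R) i :
  (forall y, differentiable f y) ->
  measurable_fun setT ((fun y => grad f y 0 i) : borel_rV R d -> R).
Proof.
move=> df; pose e : 'rV[R]_d := delta_mx 0 i.
pose g n (y : borel_rV R d) : R :=
  (harmonic n)^-1 * (f (harmonic n *: e + (y : 'rV_d)) - f y).
have fc : continuous f by move=> y; exact: differentiable_continuous.
apply: (@measurable_fun_cvg _ _ _ _ g) => [n|y _].
  apply: continuous_measurable_rV => y.
  apply: (@cvgM _ _ (nbhs y)); first exact: cvg_cst.
  apply: (@cvgB _ _ _ (nbhs y)); last exact: fc.
  apply: (@continuous_comp _ _ _ (fun y => harmonic n *: e + y) f); last exact: fc.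
  by apply: (@cvgD _ _ _ (nbhs y)); [exact: cvg_cst|exact: cvg_id].
have h0 : @harmonic R @ \oo --> (0 : R)^'.
  move=> A A0.
  have h : \forall n \near \oo, @harmonic R n != 0 -> A (harmonic n).
    exact: cvg_harmonic A0.
  apply: (@filterS _ \oo _ _ _ _ h) => n; apply.
  by rewrite gt_eqF// harmonic_gt0.
rewrite mxE; have : derivable f y e by exact: diff_derivable.
by move=> /(cvg_comp _ _ h0).
Qed.

End borel_measurability.

Section step_measurability.
Context {R : realType} {d : nat}.
Context {disp : measure_display} {Omega : measurableType disp}.
Variables (X : set 'rV[R]_d) (Z H : Omega -> 'rV[R]_d).
Hypothesis mZ : measurable_fun setT (Z : Omega -> borel_rV R d).
Hypothesis mH : measurable_fun setT (H : Omega -> borel_rV R d).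

Lemma measurable_normalized_step c : convex_set X -> compact X -> X !=set0 ->
  measurable_fun setT
    ((fun w => normalized_step X c (H w) (Z w)) : Omega -> borel_rV R d).
Proof.
move=> vX cX X0; apply: measurable_rV => i.
have mZi j := measurable_rV_coord Z j mZ; have mHi j := measurable_rV_coord H j mH.
have mn : measurable_fun setT (fun w => enorm (H w)).
  exact: measurableT_comp (continuous_measurable_rV _ enorm_continuous) mH.
rewrite (_ : (fun w => _) = (fun w => if 0 < enorm (H w) then
    Defs.proj X (Z w - c *: ((enorm (H w))^-1 *: H w)) 0 i else Z w 0 i)); last first.
  by apply/funext => w; rewrite /normalized_step; case: ifP.
apply: measurable_fun_ifT => //; first exact: measurable_fun_ltr.
have cp : continuous (fun u => Defs.proj X u 0 i).
  apply: enorm_lipschitz_continuous => u v.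
  apply: le_trans (proj_nonexpansive X u v vX cX X0).
  by rewrite (_ : _ - _ = (Defs.proj X u - Defs.proj X v) 0 i) ?enorm_coord ?mxE.
apply: (measurableT_comp (continuous_measurable_rV _ cp)).
apply: measurable_rV => j; under eq_fun do rewrite !mxE.
apply: measurable_funB => //; apply: measurable_funM => //.
apply: measurable_funM => //.
rewrite (_ : (fun w => _) = (fun w => enorm (H w) `^ (-1))); last first.
  by apply/funext => w; rewrite powR_inv1// enorm_ge0.
exact: (measurableT_comp (measurable_powR (-1)) mn).
Qed.

End step_measurability.

(** * Independence and summability *)

Section expectation_tools.
Context {R : realType} {disp : measure_display} {Omega : measurableType disp}.
Variable (P : probability Omega R).

(** On the positive half-line, the law of [V * \1_A] is [P A] times the law
    of [V]; the identity is the equality of the means of these measures. The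
    point [0] carries the mass of the complement of [A] in the first law only,
    but it does not contribute to the means. *)
Lemma integral_independent_event (A : set Omega) (V : Omega -> R) :
  measurable A -> measurable_fun setT V -> (forall w, 0 <= V w) ->
  (forall B, measurable B -> P (A `&` V @^-1` B) = (P A * P (V @^-1` B))%E) ->
  (\int[P]_w (V w * \1_A w)%:E = P A * \int[P]_w (V w)%:E)%E.
Proof.
move=> mA mV V0 ind.
pose D : set R := `]0, +oo[%classic.
have mD : measurable D by exact: measurable_itv.
have lawE (U : {mfun Omega >-> R}) : (forall w, 0 <= U w) ->
    (\int[P]_w (U w)%:E = \int[distribution P U]_(y in D) y%:E)%E.
  move=> U0; rewrite ge0_integral_pushforward//; last first.
    by move=> y; rewrite inE /D/= in_itv/= andbT lee_fin => /ltW.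
  rewrite [RHS]integral_mkcond; apply: eq_integral => w _; rewrite patchE.
  case: ifPn => //; rewrite notin_setE /D/= in_itv/= andbT => /negP.
  by rewrite -leNgt => Uw; congr EFin; apply/eqP; rewrite eq_le Uw U0.
have PA_ge0 : 0 <= fine (P A) by rewrite fine_ge0.
pose a : {nonneg R} := NngNum PA_ge0.
have aE : (a%:num%:E = P A)%E by rewrite fineK// fin_num_measure.
have mVA : measurable_fun setT (fun w => V w * \1_A w).
  by apply: measurable_funM => //; exact: measurable_indic.
pose V' : {mfun Omega >-> R} := HB.pack V (isMeasurableFun.Build _ _ _ _ V mV).
pose VA : {mfun Omega >-> R} := HB.pack (fun w => V w * \1_A w)
  (isMeasurableFun.Build _ _ _ _ _ mVA).
rewrite (lawE VA) => [|w]; last by rewrite mulr_ge0// indicE.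
rewrite (lawE V')//.
transitivity (\int[mscale a (distribution P V')]_(y in D) y%:E)%E; last first.
  rewrite ge0_integral_mscale ?aE// => y.
  by rewrite /D/= in_itv/= andbT lee_fin => /ltW.
apply: eq_measure_integral => B mB BD.
transitivity (P A * P (V @^-1` B))%E; last by rewrite -aE.
rewrite -ind//; congr (P _); apply/seteqP; split=> w /=.
  rewrite indicE; have [/set_mem Aw|_] := boolP (w \in A); first by rewrite mulr1.
  by rewrite mulr0 => /BD; rewrite /D/= in_itv/= ltxx.
by move=> [Aw]; rewrite indicE mem_set// mulr1.
Qed.

(** The sum of the [V k] has finite mean, hence is finite almost surely. *)
Lemma ae_cvg0_of_summable (V : nat -> Omega -> R) :
  (forall k, measurable_fun setT (V k)) -> (forall k w, 0 <= V k w) ->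
  (\sum_(k <oo) \int[P]_w (V k w)%:E < +oo)%E ->
  {ae P, forall w, V k w @[k --> \oo] --> (0 : R)}.
Proof.
move=> mV V0 sV.
have mVE k : measurable_fun setT (fun w => (V k w)%:E) by exact/measurable_EFinP.
pose S w := (\sum_(k <oo) (V k w)%:E)%E.
have S0 w : (0 <= S w)%E by apply: nneseries_ge0 => k _ _; rewrite lee_fin.
have : P.-integrable setT S.
  apply/integrableP; split.
    by apply: ge0_emeasurable_sum => // k w _ _; rewrite lee_fin.
  under eq_integral do rewrite gee0_abs//.
  by rewrite integral_nneseries// => k w _; rewrite lee_fin.
move=> /(integrable_ae measurableT); apply: filterS => w /(_ I) Sfin.
apply: cvg_series_cvg_0; apply: nondecreasing_is_cvgn.
  by apply: nondecreasing_series => k _ _; exact: V0.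
exists (fine (S w)) => _ [n _ <-].
rewrite -lee_fin fineK// /series/= -sumEFin; apply: nneseries_lim_ge => k _ _.
by rewrite lee_fin.
Qed.

End expectation_tools.

(** * Means of bounded variables *)

Section bounded_expectation.
Context {R : realType} {disp : measure_display} {Omega : measurableType disp}.
Variable (P : probability Omega R).

Lemma integrable_of_bounded (V : Omega -> R) (K : R) : measurable_fun setT V ->
  (forall w, `|V w| <= K) -> P.-integrable setT (EFin \o V).
Proof.
move=> mV VK; apply: measurable_bounded_integrable => //.
  by rewrite ltey_eq fin_num_measure.
exists K; split; first exact: num_real.
by move=> L KL w _; exact: le_trans (VK w) (ltW KL).
Qed.

(** One step in mean: the corrupted event [A] is independent of [V], so the
    mean of [V * \1_A] is [p] times the mean of [V], and the drift
    coefficient is [kappa - p (1 + kappa) = (1 - p) kappa - p]. *)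
Lemma expected_step (A : set Omega) (V V' : Omega -> R) (M c kappa p : R) :
  measurable A -> P A = p%:E ->
  measurable_fun setT V -> measurable_fun setT V' ->
  (forall w, 0 <= V w <= M) -> (forall w, 0 <= V' w <= M) ->
  (forall B, measurable B -> P (A `&` V @^-1` B) = (P A * P (V @^-1` B))%E) ->
  (forall w, V' w ^+ 2 <= V w ^+ 2 - 2 * c * kappa * V w
                          + 2 * c * (1 + kappa) * (V w * \1_A w) + c ^+ 2) ->
  \int[P]_w (V' w ^+ 2) <= \int[P]_w (V w ^+ 2)
     - 2 * c * ((1 - p) * kappa - p) * \int[P]_w V w + c ^+ 2.
Proof.
move=> mA PA mV mV' VM V'M ind step.
have intX (U : Omega -> R) : measurable_fun setT U -> (forall w, 0 <= U w <= M) ->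
    P.-integrable setT (EFin \o (fun w => U w ^+ 2)).
  move=> mU UM; apply: (integrable_of_bounded _ (M ^+ 2)) => [|w].
    exact: measurable_funX.
  have /andP[U0 UleM] := UM w.
  by rewrite ger0_norm ?sqr_ge0// ler_sqr// nnegrE (le_trans U0).
have mVA : measurable_fun setT (fun w => V w * \1_A w).
  by apply: measurable_funM => //; exact: measurable_indic.
have intV : P.-integrable setT (EFin \o V).
  apply: (integrable_of_bounded _ M) => // w.
  by have /andP[V0 ?] := VM w; rewrite ger0_norm.
have intVA : P.-integrable setT (EFin \o (fun w => V w * \1_A w)).
  apply: (integrable_of_bounded _ M) => // w.
  have /andP[V0 VleM] := VM w; rewrite ger0_norm ?mulr_ge0 ?indicE//.
  by case: (w \in A); rewrite ?mulr1// mulr0 (le_trans V0).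
have meanVA : \int[P]_w (V w * \1_A w) = p * \int[P]_w V w.
  rewrite /Rintegral integral_independent_event//; last first.
    by move=> w; case/andP: (VM w).
  by rewrite PA fineM//; exact: integrable_fin_num.
have int1 : P.-integrable setT (EFin \o (fun w => - (2 * c * kappa) * V w)).
  exact: (integrableZl measurableT (- (2 * c * kappa)) intV).
have int2 : P.-integrable setT
    (EFin \o (fun w => 2 * c * (1 + kappa) * (V w * \1_A w))).
  exact: (integrableZl measurableT (2 * c * (1 + kappa)) intVA).
have int3 : P.-integrable setT (EFin \o (fun=> c ^+ 2)).
  exact: (integrable_of_bounded _ `|c ^+ 2|).
have int12 : P.-integrable setT
    (EFin \o (fun w => V w ^+ 2 + (- (2 * c * kappa) * V w))).
  exact: (integrableD measurableT (intX V mV VM) int1).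
have int123 : P.-integrable setT (EFin \o (fun w => V w ^+ 2
    + (- (2 * c * kappa) * V w) + 2 * c * (1 + kappa) * (V w * \1_A w))).
  exact: (integrableD measurableT int12 int2).
have int1234 : P.-integrable setT (EFin \o (fun w => V w ^+ 2
    + (- (2 * c * kappa) * V w) + 2 * c * (1 + kappa) * (V w * \1_A w) + c ^+ 2)).
  exact: (integrableD measurableT int123 int3).
apply: (@le_trans _ _ (\int[P]_w (V w ^+ 2 + (- (2 * c * kappa) * V w)
    + 2 * c * (1 + kappa) * (V w * \1_A w) + c ^+ 2))).
  apply: le_Rintegral => // [|w _]; first exact: intX.
  by rewrite mulNr.
rewrite (RintegralD measurableT int123 int3) (RintegralD measurableT int12 int2).
rewrite (RintegralD measurableT (intX V mV VM) int1).
rewrite (RintegralZl _ measurableT intV) (RintegralZl _ measurableT intVA).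
rewrite Rintegral_cst// meanVA [X in fine X](_ : _ = 1%E)/=; last first.
  exact: probability_setT.
by rewrite le_eqVlt; apply/orP; left; apply/eqP; ring.
Qed.

End bounded_expectation.

(** * Real sequences *)

Section real_sequences.
Context {R : realType}.

Lemma le_inv_ln_succ t : (1 <= t)%N ->
  t.+1%:R^-1 <= ln t.+1%:R - ln t%:R :> R.
Proof.
move=> t1; have t0 : 0 < t%:R :> R by rewrite ltr0n.
have s0 : 0 < t.+1%:R :> R by rewrite ltr0n.
have sE : t.+1%:R = t%:R + 1 :> R by rewrite natr1.
rewrite -lerN2 opprB -ln_div ?posrE//.
rewrite (_ : t%:R / t.+1%:R = 1 + - t.+1%:R^-1 :> R); last first.
  by rewrite sE; field; rewrite -sE gt_eqF.
by apply: le_ln1Dx; rewrite ltrN2 invf_lt1// ltr1n.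
Qed.

(** Multiplying [u (t+1) <= (1 - 1/t) u t + G / t^2] by [t] makes
    [(t - 1) u t] telescope, up to the harmonic sum. *)
Lemma recursion_ln_bound (u : nat -> R) (G : R) : 0 <= G ->
  (forall t, (1 <= t)%N ->
     u t.+1 <= u t - u t / t%:R + G / t%:R ^+ 2) ->
  forall T, (1 <= T)%N -> u T.+1 <= G * (1 + ln T%:R) / T%:R.
Proof.
move=> G0 step T T1.
have T0 n : (1 <= n)%N -> 0 < n%:R :> R by rewrite ltr0n.
rewrite ler_pdivlMr ?T0//.
have stepM t : (1 <= t)%N -> u t.+1 * t%:R <= u t * (t%:R - 1) + G / t%:R.
  move=> t1; rewrite -ler_pdivlMr ?T0//; apply: le_trans (step t t1) _.
  by rewrite le_eqVlt; apply/orP; left; apply/eqP; field; rewrite gt_eqF ?T0.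
elim: T T1 => // -[_ _|t IH _].
  by have := stepM _ (leqnn 1); rewrite ln1 subrr mulr0 add0r divr1 addr0 mulr1.
have := IH isT; have := stepM t.+2 isT.
have := ler_wpM2l G0 (le_inv_ln_succ t.+1 isT).
have -> : t.+2%:R - 1 = t.+1%:R :> R by rewrite -natr1 addrK.
move: (u t.+3 * _) (u t.+2 * _) (ln t.+2%:R) (ln t.+1%:R) t.+2%:R^-1.
by move=> *; lra.
Qed.

(** Comparison with the telescoping bound
    [1 / (n+1)^2 <= 1 / n - 1 / (n+1)]. *)
Lemma summable_of_le_inv_sqr (a : nat -> R) (C : R) : 0 <= C ->
  (forall k, 0 <= a k <= C / k.+1%:R ^+ 2) ->
  (\sum_(k <oo) (a k)%:E < +oo)%E.
Proof.
move=> C0 aC.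
have partial n : \sum_(0 <= k < n.+1) a k <= C * (2 - n.+1%:R^-1).
  elim: n => [|n IH].
    rewrite big_nat1; have /andP[_] := aC 0%N; rewrite expr1n !divr1 invr1; lra.
  rewrite big_nat_recr//=; apply: le_trans (lerD IH (proj2 (andP (aC n.+1)))) _.
  rewrite -mulrDr ler_wpM2l//.
  have n0 : 0 < n.+1%:R :> R by rewrite ltr0n.
  have : (n.+2%:R ^+ 2)^-1 <= n.+1%:R^-1 - n.+2%:R^-1 :> R.
    have -> : n.+2%:R = n.+1%:R + 1 :> R by rewrite natr1.
    move: n0; move: n.+1%:R => y y0; have y1 : 0 < y + 1 by rewrite addr_gt0.
    rewrite (_ : y^-1 - _ = (y * (y + 1))^-1); last by field; rewrite !gt_eqF.
    by rewrite lef_pV2 ?posrE ?exprn_gt0 ?mulr_gt0// expr2 ler_pM2r// lerDl.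
  by move: (_ ^-1) (n.+1%:R^-1) (n.+2%:R^-1) => *; lra.
apply: (@le_lt_trans _ _ (C * 2)%:E); last exact: ltry.
apply: lime_le.
  by apply: is_cvg_nneseries => k _ _; rewrite lee_fin; case/andP: (aC k).
apply: nearW => n; rewrite sumEFin lee_fin.
case: n => [|n]; first by rewrite big_geq// mulr_ge0.
by apply: le_trans (partial n) _; rewrite ler_wpM2l// gerBl invr_ge0.
Qed.

(** Between the times [(k+1)^3 + 1] and [(k+2)^3] the sequence moves by at
    most [7 (k+1)^2 * g / (k+1)^3]. *)
Lemma cvg0_of_cube_subsequence (a : nat -> R) (g : R) : 0 <= g ->
  (forall t, 0 <= a t) ->
  (forall t, (1 <= t)%N -> a t.+1 <= a t + g / t%:R) ->
  a (k.+1 ^ 3).+1 @[k --> \oo] --> (0 : R) ->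
  a t @[t --> \oo] --> (0 : R).
Proof.
move=> g0 a0 move_a sub0; apply/cvgr0Pnorm_lt => e e0.
have e20 : 0 < e / 2 by rewrite divr_gt0.
have [K1 _ K1P] : \forall k \near \oo, `|a (k.+1 ^ 3).+1| < e / 2.
  by move/cvgr0Pnorm_lt : sub0; apply.
have [K2 _ K2P] : \forall k \near \oo, `|7 * g * @harmonic R k| < e / 2.
  suff : 7 * g * @harmonic R k @[k --> \oo] --> (0 : R).
    by move/cvgr0Pnorm_lt; apply.
  by rewrite -(mulr0 (7 * g)); apply: cvgMr; exact: cvg_harmonic.
pose K := maxn K1 K2.
exists (K.+1 ^ 3).+1 => // t /= Kt.
have [k Kk /andP[kt tk]] : exists2 k, (K <= k)%N & (k.+1 ^ 3 < t <= k.+2 ^ 3)%N.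
  pose Q m := (m.+1 ^ 3 < t)%N.
  have Qub m : Q m -> (m <= t)%N.
    by move=> /ltnW; apply: leq_trans; rewrite !expnS expn0; nia.
  case: (ex_maxnP (ex_intro _ K Kt : exists m, Q m) Qub) => k Qk kmax.
  exists k; first exact: kmax.
  apply/andP; split=> //.
  by rewrite leqNgt; apply/negP => /kmax; rewrite ltnn.
have k0 : 0 < k.+1%:R :> R by rewrite ltr0n.
have gap j : a (k.+1 ^ 3 + j).+1 <= a (k.+1 ^ 3).+1 + j%:R * (g / (k.+1 ^ 3)%:R).
  elim: j => [|j IH]; first by rewrite addn0 mul0r addr0.
  rewrite addnS; apply: le_trans (move_a _ _) _ => //.
  rewrite -[j.+1%:R]natr1 mulrDl mul1r addrA lerD// ler_wpM2l//.
  by rewrite lef_pV2 ?posrE ?ltr0n ?expn_gt0// ler_nat leqW// leq_addr.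
have := gap (t - (k.+1 ^ 3).+1)%N; rewrite -addSn subnKC// => at_le.
(* [(K + 1)^3 - K^3 = 3 K^2 + 3 K + 1 <= 7 K^2] *)
have jump : (t - (k.+1 ^ 3).+1)%:R <= 7 * k.+1%:R ^+ 2 :> R.
  rewrite -natrX -natrM ler_nat leq_subLR.
  by apply: leq_trans tk _; rewrite !expnS expn0; nia.
rewrite ger0_norm//; apply: le_lt_trans at_le _.
have := K1P k (leq_trans (leq_maxl _ _) Kk); rewrite /= ger0_norm// => sub_lt.
have := K2P k (leq_trans (leq_maxr _ _) Kk).
rewrite /= ger0_norm ?mulr_ge0 ?invr_ge0// => har_lt.
suff : (t - (k.+1 ^ 3).+1)%:R * (g / (k.+1 ^ 3)%:R) <= 7 * g / k.+1%:R.
  by move: sub_lt har_lt; move: (a _) (_ * (g / _)) (7 * g / _) => *; lra.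
apply: le_trans (ler_wpM2r _ jump) _; first by rewrite divr_ge0.
by rewrite natrX le_eqVlt; apply/orP; left; apply/eqP; field; rewrite gt_eqF.
Qed.

End real_sequences.

(** * Distance to the minimizers *)

Section normalized_subgradient.
Context {R : realType} {d : nat}.
Variables (X : set 'rV[R]_d) (f : 'rV[R]_d -> R) (xstar : 'rV[R]_d -> 'rV[R]_d).
Variable phi : R.
Hypothesis X_convex : convex_set X.
Hypothesis X_compact : compact X.
Hypothesis xstarP : forall y, nearest (argmin X f) y (xstar y).

Definition dist_argmin x := enorm (x - xstar x).

Lemma dist_argmin_ge0 x : 0 <= dist_argmin x. Proof. exact: enorm_ge0. Qed.

Lemma dist_argmin_lipschitz x y :
  `|dist_argmin x - dist_argmin y| <= enorm (x - y).
Proof. exact: nearest_dist_lipschitz. Qed.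

Lemma xstar_in y : X (xstar y). Proof. by have [[]] := xstarP y. Qed.

Lemma dist_argmin_le_diameter x : X x -> dist_argmin x <= diameter X.
Proof. by move=> Xx; apply: le_diameter => //; exact: xstar_in. Qed.

(** Where the gradient does not vanish this is the angle condition. Where it
    does, the right-hand side is [0], and so is the left-hand side: weak
    pseudo-convexity makes every stationary point of [X] a minimizer. *)
Lemma acute_normalized x : weakly_pseudo_convex X f xstar ->
  acute_angle X f xstar phi -> X x ->
  cos phi * dist_argmin x <= dot (grad f x) (x - xstar x) / enorm (grad f x).
Proof.
move=> [K K0 wpc] acute Xx.
have [g0|g0] := eqVneq (enorm (grad f x)) 0; last first.
  have gp : 0 < enorm (grad f x) by rewrite lt_def g0 enorm_ge0.
  by rewrite ler_pdivlMr// mulrAC acute.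
have fx : f x <= f (xstar x).
  by have := wpc x Xx; rewrite g0 invr0 !mulr0 subr_le0.
have [[_ fmin] near_x] := xstarP x.
have /near_x : argmin X f x.
  by split=> // z Xz; exact: le_trans fx (fmin z Xz).
rewrite subrr enorm0 => D0.
have -> : dist_argmin x = 0 by apply/eqP; rewrite eq_le D0 enorm_ge0.
by rewrite g0 invr0 !mulr0.
Qed.

(** A corrupted direction still has norm at most [1], hence costs at most
    [2 c D]; an honest one gains [2 c cos phi D]. *)
Lemma dist_argmin_step (c : R) (corrupted : bool) v x :
  weakly_pseudo_convex X f xstar -> acute_angle X f xstar phi -> X x -> 0 <= c ->
  dist_argmin (normalized_step X c (if corrupted then v else grad f x) x) ^+ 2
  <= dist_argmin x ^+ 2 - 2 * c * cos phi * dist_argmin x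
     + 2 * c * (1 + cos phi) * (dist_argmin x * corrupted%:R) + c ^+ 2.
Proof.
move=> wpc acute Xx c0; set h := if _ then _ else _; set y := normalized_step _ _ _ _.
apply: (@le_trans _ _ (enorm (y - xstar x) ^+ 2)).
  rewrite ler_sqr ?nnegrE ?enorm_ge0//.
  by have [_] := xstarP y; apply; have [] := xstarP x.
apply: le_trans (normalized_step_sqr_dist X c h x _ X_convex X_compact (xstar_in x)) _.
rewrite lerD2r -addrA lerD2l.
have c20 : 0 <= 2 * c by rewrite mulr_ge0.
rewrite {y}/h; case: corrupted => /=.
  have := ler_wpM2l c20 (ler_normalized_dot v (x - xstar x)).
  by rewrite -/(dist_argmin x) mulr1 mulrN; nra.
have := ler_wpM2l c20 (acute_normalized x wpc acute Xx).
by move: (dist_argmin x) (dot _ _ / _) => D g; lra.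
Qed.

(** Both distances are at most the diameter and differ by at most [c]. *)
Lemma dist_argmin_sqr_move c h x : X x -> 0 <= c ->
  dist_argmin (normalized_step X c h x) ^+ 2
  <= dist_argmin x ^+ 2 + 2 * diameter X * c.
Proof.
move=> Xx c0; set y := normalized_step _ _ _ _.
have Xy : X y by exact: normalized_step_in.
have := le_trans (ler_norm _) (le_trans (dist_argmin_lipschitz y x)
  (normalized_step_move X c h x X_convex X_compact Xx c0)).
have := dist_argmin_le_diameter y Xy; have := dist_argmin_le_diameter x Xx.
have := dist_argmin_ge0 y; have := dist_argmin_ge0 x.
move: (dist_argmin x) (dist_argmin y) => u v u0 v0 uM vM vu.
have : (v - u) * (v + u) <= c * (v + u) by rewrite ler_wpM2r// addr_ge0.
have : c * (v + u) <= c * (2 * diameter X) by rewrite ler_wpM2l//; lra.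
nra.
Qed.

End normalized_subgradient.

(** * The stochastic process *)

Section process.
Context {R : realType} {d : nat} {disp : measure_display}.
Context {Omega : measurableType disp}.

Lemma measurable_feedback (f : 'rV[R]_d -> R) (x b : nat -> Omega -> 'rV[R]_d)
    (Y : nat -> Omega -> bool) t :
  (forall y, differentiable f y) ->
  measurable_fun setT (x t : Omega -> borel_rV R d) ->
  measurable_fun setT (b t : Omega -> borel_rV R d) ->
  measurable_fun setT (Y t) ->
  measurable_fun setT (feedback f x b Y t : Omega -> borel_rV R d).
Proof.
move=> df mx mb mY; apply: measurable_rV => i.
rewrite (_ : (fun w => _) =
    (fun w => if Y t w then b t w 0 i else grad f (x t w) 0 i)); last first.
  by apply/funext => w; rewrite /feedback; case: (Y t w).
apply: measurable_fun_ifT => //; first exact: measurable_rV_coord.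
exact: (measurableT_comp (measurable_grad f i df) mx).
Qed.

(** The current iterate belongs to the history, so the current corruption
    flag is independent of every continuous function of it. *)
Lemma independent_of_iterate (P : probability Omega R)
    (x b : nat -> Omega -> 'rV[R]_d) (Y : nat -> Omega -> bool)
    (g : 'rV[R]_d -> R) t B :
  independent_of P (Y t) (history x b Y t) -> (1 <= t)%N -> continuous g ->
  measurable B ->
  P (Y t @^-1` [set true] `&` (g \o x t) @^-1` B) =
  (P (Y t @^-1` [set true]) * P ((g \o x t) @^-1` B))%E.
Proof.
move=> ind t1 cg mB; apply: ind => //.
apply: sub_sigma_algebra; left; exists t => /=; first by rewrite t1 leqnn.
exists (g @^-1` B); last by rewrite setTI.
by have := continuous_measurable_rV g cg measurableT B mB; rewrite setTI.
Qed.

End process.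

Theorem corollary2 (R : realType) (d : nat)
  (X : set 'rV[R]_d) (f : 'rV[R]_d -> R) (xstar : 'rV[R]_d -> 'rV[R]_d)
  (phi p q gamma : R) (x1 : 'rV[R]_d)
  (disp : measure_display) (Omega : measurableType disp)
  (P : probability Omega R)
  (Y : nat -> {RV P >-> bool}) (b : nat -> {RV P >-> borel_rV R d})
  (x : nat -> Omega -> 'rV[R]_d)
  (X_nonempty : X !=set0) (X_convex : convex_set X) (X_compact : compact X)
  (f_diff : forall y, differentiable f y)
  (xstarP : forall y, nearest (argmin X f) y (xstar y))
  (f_wpc : weakly_pseudo_convex X f xstar)
  (phi_range : 0 <= phi < pi / 2)
  (f_acute : acute_angle X f xstar phi)
  (p_ge0 : 0 <= p) (p_lt : p < cos phi / (1 + cos phi))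
  (q_range : p <= q < cos phi / (1 + cos phi))
  (gammaE : gamma = diameter X / (2 * ((1 - q) * cos phi - q)))
  (x1_X : X x1)
  (Y_bernoulli : forall t, (1 <= t)%N -> P (Y t @^-1` [set true]) = p%:E)
  (Y_indep : forall t, (1 <= t)%N -> independent_of P (Y t) (history x b Y t))
  (x_init : forall w, x 1%N w = x1)
  (x_step : forall t w, (1 <= t)%N ->
     x t.+1 w = normalized_step X (gamma / t%:R) (feedback f x b Y t w) (x t w)) :
  (forall T : nat, (1 <= T)%N ->
     ('E_P[fun w => (enorm (x T.+1 w - xstar (x T.+1 w)) ^+ 2)%R]
        <= (gamma ^+ 2 * (1 + ln T%:R) / T%:R)%:E)%E) /\
  {ae P, forall w,
     (fun t => enorm (x t w - xstar (x t w)) ^+ 2) @ \oo --> (0 : R)}.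
Proof.
pose M := diameter X; pose D t w := dist_argmin xstar (x t w).
have cos0 : 0 < cos phi.
  have /andP[phi0 phi1] := phi_range; apply: cos_gt0_pihalf; rewrite phi1 andbT.
  by rewrite (lt_le_trans _ phi0)// oppr_lt0 divr_gt0// pi_gt0.
have M0 : 0 <= M by exact: diameter_ge0 X_compact x1_X.
have /andP[pq q_lt] := q_range.
have drift0 : 0 < (1 - q) * cos phi - q.
  by move: q_lt; rewrite ltr_pdivlMr; [lra|rewrite addr_gt0].
have gamma0 : 0 <= gamma by rewrite gammaE divr_ge0// mulr_ge0// ltW.
have xX t w : (1 <= t)%N -> X (x t w).
  elim: t => // -[_ _|t IH _]; first by rewrite x_init.
  by rewrite x_step//; apply: normalized_step_in => //; exact: IH.
have mx t : (1 <= t)%N -> measurable_fun setT (x t : Omega -> borel_rV R d).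
  elim: t => // -[_ _|t IH _].
    by rewrite (_ : x 1%N = cst x1)//; apply/funext => w; rewrite x_init.
  rewrite (_ : x t.+2 = fun w =>
      normalized_step X (gamma / t.+1%:R) (feedback f x b Y t.+1 w) (x t.+1 w)); last first.
    by apply/funext => w; rewrite x_step.
  have mxt := IH isT.
  apply: measurable_normalized_step => //.
  by apply: (measurable_feedback f x b Y).
have Dc : continuous (dist_argmin xstar).
  apply: enorm_lipschitz_continuous; exact: dist_argmin_lipschitz xstarP.
have mD t : (1 <= t)%N -> measurable_fun setT (D t).
  by move=> t1; exact: (measurableT_comp (continuous_measurable_rV _ Dc) (mx t t1)).
have D_range t w : (1 <= t)%N -> 0 <= D t w <= M.
  move=> t1; rewrite dist_argmin_ge0 /=.
  by apply: (dist_argmin_le_diameter X f) => //; exact: xX.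
have mD2 t : (1 <= t)%N -> measurable_fun setT (fun w => D t w ^+ 2).
  by move=> t1; apply: measurable_funX; exact: mD.
have int_D t : (1 <= t)%N -> P.-integrable setT (EFin \o D t).
  move=> t1; apply: (integrable_of_bounded P _ M) => [|w]; first exact: mD.
  by have /andP[? ?] := D_range t w t1; rewrite ger0_norm.
have int_D2 t : (1 <= t)%N -> P.-integrable setT (EFin \o (fun w => D t w ^+ 2)).
  move=> t1; apply: (integrable_of_bounded P _ (M ^+ 2)) => [|w]; first exact: mD2.
  have /andP[D0 DM] := D_range t w t1.
  by rewrite ger0_norm ?sqr_ge0// ler_sqr.
pose u t := \int[P]_w (D t w ^+ 2).
have u_step t : (1 <= t)%N -> u t.+1 <= u t - u t / t%:R + gamma ^+ 2 / t%:R ^+ 2.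
  move=> t1; have t0 : 0 < t%:R :> R by rewrite ltr0n.
  pose v := \int[P]_w D t w.
  have v0 : 0 <= v by apply: Rintegral_ge0 => w _; exact: dist_argmin_ge0.
  have uv : u t <= M * v.
    rewrite -RintegralZl//; last exact: int_D.
    apply: le_Rintegral => //; first exact: int_D2.
      exact: (integrableZl measurableT M (int_D t t1)).
    move=> w _; have /andP[D0 DM] := D_range t w t1.
    by rewrite expr2 ler_wpM2r.
  have : u t.+1 <= u t - 2 * (gamma / t%:R) * ((1 - p) * cos phi - p) * v
                   + (gamma / t%:R) ^+ 2.
    apply: (expected_step P (Y t @^-1` [set true]) _ _ M) => //.
    - by rewrite -[X in measurable X]setTI; exact: measurable_funP.
    - exact: Y_bernoulli.
    - exact: mD.
    - exact: mD.
    - by move=> w; exact: D_range.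
    - by move=> w; exact: D_range.
    - move=> B mB; exact: (independent_of_iterate P x b Y _ t B (Y_indep t t1) t1 Dc mB).
    - move=> w; rewrite /D x_step// indicE.
      have -> : w \in Y t @^-1` [set true] = Y t w.
        by apply/idP/idP => [/set_mem//|Yw]; apply/mem_set.
      apply: (dist_argmin_step X f) => //; first exact: xX.
      by rewrite divr_ge0.
  move=> /le_trans; apply; rewrite expr_div_n lerD2r lerD2l lerN2.
  (* [gamma] is such that the drift coefficient for [q] times [2 gamma] is [M],
     and the coefficient for [p <= q] is larger. *)
  apply: (@le_trans _ _ (M * v / t%:R)); first by rewrite ler_pM2r ?invr_gt0.
  rewrite (_ : 2 * _ * _ * v = 2 * gamma * ((1 - p) * cos phi - p) * v / t%:R);
    last by field; rewrite gt_eqF.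
  rewrite ler_pM2r ?invr_gt0// ler_wpM2r//.
  rewrite (_ : M = 2 * gamma * ((1 - q) * cos phi - q)); last first.
    by rewrite gammaE -/M; field; rewrite gt_eqF.
  by rewrite ler_wpM2l ?mulr_ge0//; nra.
have u_bound := recursion_ln_bound u (gamma ^+ 2) (sqr_ge0 _) u_step.
have uE t : (1 <= t)%N -> (\int[P]_w (D t w ^+ 2)%:E = (u t)%:E)%E.
  by move=> t1; rewrite fineK//; exact: integrable_fin_num (int_D2 t t1).
split=> [T T1|].
  by rewrite unlock uE// lee_fin u_bound.
have sub_ae : {ae P, forall w, D (k.+1 ^ 3).+1 w ^+ 2 @[k --> \oo] --> (0 : R)}.
  apply: ae_cvg0_of_summable => [k|k w|]; [exact: mD2|exact: sqr_ge0|].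
  under eq_eseriesr do rewrite uE//.
  apply: (summable_of_le_inv_sqr _ (4 * gamma ^+ 2)) => [|k].
    by rewrite mulr_ge0 ?sqr_ge0.
  rewrite Rintegral_ge0 => [|w _]; last exact: sqr_ge0.
  apply: le_trans (u_bound _ _) _; first by rewrite expn_gt0.
  have k0 : 0 < k.+1%:R :> R by rewrite ltr0n.
  (* [1 + ln (K ^ 3) = 1 + 3 ln K <= 4 K] *)
  have ln_le : 1 + ln (k.+1 ^ 3)%:R <= 4 * k.+1%:R :> R.
    have k1 : 1 <= k.+1%:R :> R by rewrite ler1n.
    by rewrite natrX lnXn// mulr_natl; have := ln_sublinear k0; lra.
  have := ler_wpM2l (sqr_ge0 gamma) ln_le.
  rewrite -(ler_pM2r (_ : 0 < ((k.+1 ^ 3)%:R)^-1 :> R)) => [/le_trans|]; last first.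
    by rewrite invr_gt0 ltr0n expn_gt0.
  apply; rewrite natrX le_eqVlt; apply/orP; left; apply/eqP; field.
  by rewrite gt_eqF.
move: sub_ae; apply: filterS => w; apply: (cvg0_of_cube_subsequence _ (2 * M * gamma)).
- by rewrite !mulr_ge0.
- by move=> t; exact: sqr_ge0.
- move=> t t1; rewrite /D x_step// -mulrA.
  apply: (dist_argmin_sqr_move X f) => //; first exact: xX.
  by rewrite divr_ge0.
Qed.
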